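(* Let $\xi=(G,\mathcal{L},\mathcal{A})$ be a reducible triplet, let $\xi^{(1)}=(G,\mathcal{L}^{(1)},\mathcal{A}^{(1)})$ be a strictly embedded triplet in $\xi$, for every vertex $i$ let $L_i^{(2)}$ be any subspace with $L_i=L_i^{(1)}\oplus L_i^{(2)}$, and let $\xi^{(2)}=(G,\mathcal{L}^{(2)},\mathcal{A}^{(2)})$ be the triplet in which each edge from $i$ to $j$ with operator $A_{ji}$ in $\xi$ carries the operator $A_{ji}^{(2)}=P_j\circ A_{ji}|_{L_i^{(2)}}:L_i^{(2)}\to L_j^{(2)}$, where $P_j:L_j\to L_j^{(2)}$ is the projection parallel to $L_j^{(1)}$. Then $\xi^{(1)}$ and $\xi^{(2)}$ both have total dimension ($\sum_i\dim$ of the spaces) smaller than that of $\xi$; in bases of the spaces $L_i$ composed of bases of $L_i^{(1)}$ and $L_i^{(2)}$, every $A_{ji}\in\mathcal{A}$ has the block upper triangular form $$A_{ji}=\begin{pmatrix}A_{ji}^{(1)} & D_{ji}\\ 0 & A_{ji}^{(2)}\end{pmatrix},$$ where $A_{ji}^{(1)}=A_{ji}|_{L_i^{(1)}}$; and $$\rho(\xi)=\max\{\rho(\xi^{(1)}),\rho(\xi^{(2)})\}.$$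
   Context: A triplet (system) $\xi=(G,\mathcal{L},\mathcal{A})$ consists of: a finite directed multigraph $G$ with vertices $1,\dots,n$ (loops and multiple edges allowed, finitely many edges); finite-dimensional real linear spaces $\mathcal{L}=(L_1,\dots,L_n)$, $L_i$ attached to vertex $i$ (some, but not all, of them may be $\{0\}$); and, for every edge from $i$ to $j$, a linear operator $A_{ji}:L_i\to L_j$. $\mathcal{A}_{ji}$ is the finite (possibly empty) family of operators of edges from $i$ to $j$, and $\mathcal{A}=\bigcup_{i,j}\mathcal{A}_{ji}$. A path $\alpha$ is a sequence of consecutive edges; $|\alpha|$ is its number of edges. For a path $i_1\to i_2\to\dots\to i_{k+1}$ with operators $A_{i_{s+1}i_s}$, $\Pi_\alpha=A_{i_{k+1}i_k}\cdots A_{i_2i_1}:L_{i_1}\to L_{i_{k+1}}$. A multinorm is a collection of norms $\|\cdot\|_i$ on $L_i$, $i=1,\dots,n$; for an operator $A:L_i\to L_j$, $\|A\|=\sup_{\|x\|_i=1}\|Ax\|_j$ ($0$ if $L_i=\{0\}$). The joint spectral radius is $\rho(\xi)=\lim_{k\to\infty}\max_{|\alpha|=k}\|\Pi_\alpha\|^{1/k}$ (the limit exists and does not depend on the multinorm; a maximum over an empty set is $0$). A triplet $\xi'=(G,\mathcal{L}',\mathcal{A}')$ (same multigraph, spaces not all zero) is embedded in $\xi$ if $L_i'\subset L_i$ is a subspace for each $i$ and for every edge from $i$ to $j$ its operator in $\xi'$ is the restriction $A_{ji}|_{L_i'}$, which maps $L_i'$ into $L_j'$. The embedding is strict if $L_i'\ne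 L_i$ for at least one $i$. $\xi$ is reducible if it has a strictly embedded triplet, and irreducible otherwise. *)

(* Defs.v *)
(* MathComp / MathComp-Analysis *)
From HB Require Import structures.
From mathcomp Require Import all_boot all_order all_algebra.
From mathcomp Require Import all_classical all_reals all_analysis.

Set Implicit Arguments.
Unset Strict Implicit.
Unset Printing Implicit Defensive.

Import Order.TTheory GRing.Theory Num.Theory.
Import numFieldNormedType.Exports.
Local Open Scope classical_set_scope.
Local Open Scope ring_scope.

Record multigraph := Multigraph {
  nvert : nat;
  edge : 'I_nvert -> 'I_nvert -> finType (* edge i j: the edges from i to j *)
}.

Record triplet (R : realType) (G : multigraph) := Triplet {
  vtx_space : 'I_(nvert G) -> vectType R;
  oper : forall i j, edge i j -> 'Hom(vtx_space i, vtx_space j);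
  _ : exists i, (0 < \dim {: vtx_space i})%N
}.

Definition total_dim (R : realType) (G : multigraph) (xi : triplet R G) : nat :=
  (\sum_i \dim {: vtx_space xi i})%N.

Section Paths.
Variables (R : realType) (G : multigraph).

(* Paths with k edges starting at i: a first edge i -> j, then a path with
   k - 1 edges starting at j. *)
Fixpoint gpath (k : nat) (i : 'I_(nvert G)) : finType :=
  if k is k'.+1 then {j : 'I_(nvert G) & (edge i j * gpath k' j)%type} : finType
  else unit : finType.

Fixpoint endpoint (k : nat) : forall i, gpath k i -> 'I_(nvert G) :=
  if k is k'.+1 return forall i, gpath k i -> 'I_(nvert G)
  then fun i a => endpoint (tagged a).2
  else fun i _ => i.

Fixpoint path_prod (xi : triplet R G) (k : nat) :
    forall i (a : gpath k i), 'Hom(vtx_space xi i, vtx_space xi (endpoint a)) :=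
  if k is k'.+1
    return forall i (a : gpath k i), 'Hom(vtx_space xi i, vtx_space xi (endpoint a))
  then fun i a => (path_prod xi (tagged a).2 \o oper xi (tagged a).1)%VF
  else fun i _ => \1%VF.

End Paths.

Record is_norm (R : realType) (V : lmodType R) (N : V -> R) : Prop := IsNorm {
  norm_triangle : forall x y, N (x + y) <= N x + N y;
  norm_homog : forall (a : R) x, N (a *: x) = `|a| * N x;
  norm_definite : forall x, N x = 0 -> x = 0
}.

Record multinorm (R : realType) (G : multigraph) (xi : triplet R G) :=
  Multinorm {
  mnorm :> forall i, vtx_space xi i -> R;
  mnormP : forall i, is_norm (mnorm (i := i))
}.

(* If U = {0} the unit sphere is empty, and sup set0 = 0. *)
Definition opnorm (R : realType) (U V : vectType R) (NU : U -> R) (NV : V -> R)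
    (A : 'Hom(U, V)) : R :=
  sup [set NV (A x) | x in [set x | NU x = 1]].

(* The maximum of nonnegative numbers with neutral element 0, hence 0 when there
   is no path with k edges. *)
Definition max_path_norm (R : realType) (G : multigraph) (xi : triplet R G)
    (N : multinorm xi) (k : nat) : R :=
  \big[Num.max/0]_(a : {i : 'I_(nvert G) & gpath k i})
     opnorm (N (tag a)) (N (endpoint (tagged a))) (path_prod xi (tagged a))
       `^ (k%:R^-1).

(* The joint spectral radius, computed with the multinorm N. *)
Definition jsr (R : realType) (G : multigraph) (xi : triplet R G)
    (N : multinorm xi) : R :=
  limn (max_path_norm N).

Section Embedding.
Variables (R : realType) (G : multigraph).

Record embedded (xi : triplet R G) := Embedded {
  sub_space : forall i, {vspace vtx_space xi i};
  sub_oper : forall i j, edge i j ->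
    'Hom(subvs_of (sub_space i), subvs_of (sub_space j));
  sub_operE : forall i j (e : edge i j) (x : subvs_of (sub_space i)),
    vsval (sub_oper e x) = oper xi e (vsval x);
  sub_neq0 : exists i, sub_space i != 0%VS
}.

Lemma subspaces_nontriv (V : 'I_(nvert G) -> vectType R)
    (U : forall i, {vspace V i}) :
  (exists i, U i != 0%VS) -> exists i, (0 < \dim {: subvs_of (U i)})%N.
Proof. by case=> i Ui; exists i; rewrite dimvf lt0n dimv_eq0. Qed.

Definition embedded_triplet (xi : triplet R G) (xi1 : embedded xi) :
    triplet R G :=
  Triplet (@sub_oper xi xi1) (subspaces_nontriv (sub_neq0 xi1)).

Definition strict (xi : triplet R G) (xi1 : embedded xi) : Prop :=
  exists i, sub_space xi1 i != fullv.

Definition reducible (xi : triplet R G) : Prop :=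
  exists xi1 : embedded xi, strict xi1.

Definition complementary (xi : triplet R G) (xi1 : embedded xi)
    (L2 : forall i, {vspace vtx_space xi i}) : Prop :=
  forall i, (sub_space xi1 i + L2 i)%VS = fullv /\ directv (sub_space xi1 i + L2 i).

(* The projection onto U parallel to W, with values in U as a space; on U, vsproj
   is the corestriction. *)
Definition proj_along (V : vectType R) (U W : {vspace V}) :
    'Hom(V, subvs_of U) :=
  linfun (vsproj U \o daddv_pi U W).

Lemma complement_neq0 (xi : triplet R G) (xi1 : embedded xi)
    (L2 : forall i, {vspace vtx_space xi i}) :
  strict xi1 -> complementary xi1 L2 -> exists i, L2 i != 0%VS.
Proof.
case=> i hi hc; exists i; apply: contra_neq hi => L20.
by case: (hc i) => <- _; rewrite L20 addv0.
Qed.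

Definition complement_triplet (xi : triplet R G) (xi1 : embedded xi)
    (L2 : forall i, {vspace vtx_space xi i})
    (st1 : strict xi1) (hL2 : complementary xi1 L2) : triplet R G :=
  Triplet
    (fun i j (e : edge i j) =>
       (proj_along (L2 j) (sub_space xi1 j) \o oper xi e \o
          linfun (vsval : subvs_of (L2 i) -> vtx_space xi i))%VF)
    (subspaces_nontriv (complement_neq0 st1 hL2)).

End Embedding.

Section Matrices.
Variables (R : realType).

(* Column convention: column c holds the coordinates of f X_c in the basis Y (the
   library's mxof acts on row vectors and gives the transpose). *)
Definition mx_in_bases (m p : nat) (U V : vectType R)
    (X : m.-tuple U) (Y : p.-tuple V) (f : 'Hom(U, V)) : 'M[R]_(p, m) :=
  \matrix_(r, c) coord Y r (f X`_c).

Definition adapted_family (m p : nat) (V : vectType R) (U W : {vspace V})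
    (X : m.-tuple (subvs_of U)) (Y : p.-tuple (subvs_of W)) :
    (m + p).-tuple V :=
  [tuple of map vsval X ++ map vsval Y].

Lemma vsval_basis (V : vectType R) (U : {vspace V}) (X : seq (subvs_of U)) :
  basis_of fullv X -> basis_of U (map vsval X).
Proof.
move=> hX.
have E : map vsval X = map (linfun (vsval : subvs_of U -> V)) X.
  by apply: eq_map => x; rewrite lfunE.
have EU : (linfun (vsval : subvs_of U -> V) @: fullv)%VS = U.
  apply/vspaceP => v; apply/idP/idP => [/memv_imgP [u _ ->]|vU].
    by rewrite lfunE /= subvsP.
  by apply/memv_imgP; exists (vsproj U v); rewrite ?memvf // lfunE /= vsprojK.
rewrite E -[X in basis_of X]EU; apply: limg_basis_of hX.
apply/eqP; rewrite capfv; apply/eqP/eqP/lker0P => x y.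
by rewrite !lfunE; apply: val_inj.
Qed.

Lemma adapted_family_basis (m p : nat) (V : vectType R) (U W : {vspace V})
    (X : m.-tuple (subvs_of U)) (Y : p.-tuple (subvs_of W)) :
  (U + W)%VS = fullv -> directv (U + W) ->
  basis_of fullv X -> basis_of fullv Y -> basis_of fullv (adapted_family X Y).
Proof.
move=> <- dUW hX hY; apply: cat_basis => //; exact: vsval_basis.
Qed.

End Matrices.

(* Main.v *)
Require Import Defs.
From HB Require Import structures.
From mathcomp Require Import all_boot all_order all_algebra.
From mathcomp Require Import all_classical all_reals all_analysis ring.

Set Implicit Arguments.
Unset Strict Implicit.
Unset Printing Implicit Defensive.

Import Order.TTheory GRing.Theory Num.Theory.
Import numFieldNormedType.Exports.
Local Open Scope classical_set_scope.
Local Open Scope ring_scope.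

(** The block form says that L_1 is invariant and that projecting along L_1 onto
    L_2 intertwines the system with its compression to L_2. Hence the diagonal
    blocks of a path product are the path products of the two smaller systems
    (path_prod_sub, proj_path_prod), and the dimensions add up, both summands being
    positive. The rest concerns the formula for the joint spectral radius.

    That formula is a comparison of growth rates. The path maxima M_k are
    submultiplicative, so by Fekete's lemma (submult_root_cvg) M_k^(1/k) converges,
    and its limit is the infimum of the r > 0 for which M_k <= C r^k holds for all
    k with some C (jsr_lt_growth, jsr_le). In this form the radius is insensitive
    to constant factors: all norms on a finite-dimensional space are equivalent
    (norm_hom_le), and inclusions and projections are bounded.

    A bound C r^k for the whole system passes to both diagonal blocks
    (growth_bound_compress). Conversely, suppose that both blocks satisfy such
    bounds with the same r. The off-diagonal block of a path of length k is a sum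
    of k terms, one for each edge at which the path crosses from L_2 to L_1, and
    each term is at most a constant times r^k (offdiag_le). So the whole system
    grows at most like (k+1) r^k, which is at most a constant times s^k for any
    s > r (linear_expr_le). *)

(** * Norms on finite-dimensional spaces *)

Section NormFacts.
Variables (R : realType) (V : lmodType R) (N : V -> R).
Hypothesis hN : is_norm N.

Lemma is_norm0 : N 0 = 0.
Proof. by rewrite -(scale0r 0) (norm_homog hN) normr0 mul0r. Qed.

Lemma is_normN x : N (- x) = N x.
Proof. by rewrite -scaleN1r (norm_homog hN) normrN1 mul1r. Qed.

Lemma is_norm_ge0 x : 0 <= N x.
Proof.
rewrite -(pmulrn_lge0 _ (isT : (0 < 2)%N)) mulr2n -[X in _ + X]is_normN.
by rewrite -is_norm0 -(subrr x) (norm_triangle hN).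
Qed.

Lemma is_norm_sum (I : finType) (f : I -> V) : N (\sum_i f i) <= \sum_i N (f i).
Proof.
elim/big_ind2: _ => [|a b c d ab cd|//]; first by rewrite is_norm0.
exact: le_trans (norm_triangle hN _ _) (lerD ab cd).
Qed.

Lemma is_norm_distl x y : `|N x - N y| <= N (x - y).
Proof.
have sub a b : N a - N b <= N (a - b).
  by rewrite lerBlDr -{1}(subrK b a) (norm_triangle hN).
by rewrite ler_norml sub andbT lerNl opprB -(is_normN (x - y)) opprB sub.
Qed.

End NormFacts.

(** Compactness of the unit sphere of the coordinate space: a norm, being
    continuous in the coordinates, has a positive minimum on it. *)
Lemma coord_le_norm (R : realType) (V : vectType R) (N : V -> R) n
    (b : n.-tuple V) :
  is_norm N -> basis_of fullv b ->
  exists2 C, 0 <= C & forall x i, `|coord b i x| <= C * N x.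
Proof.
move=> hN hb; have fb := basis_free hb.
pose phi (u : 'rV[R]_n) := \sum_(i < n) u 0 i *: b`_i.
pose K := \sum_(i < n) N b`_i.
have phiB u v : phi (u - v) = phi u - phi v.
  rewrite /phi -sumrB; apply: eq_bigr => i _.
  by rewrite !mxE scalerBl.
have entry_le (u : 'rV[R]_n) i : `|u 0 i| <= `|u|.
  rewrite [leRHS]/Num.norm /= mx_normrE.
  exact: (le_bigmax _ (fun ij : 'I_1 * 'I_n => `|u ij.1 ij.2|) (0, i)).
have phi_le u : N (phi u) <= K * `|u|.
  apply: le_trans (is_norm_sum hN _) _; rewrite mulr_suml; apply: ler_sum => i _.
  by rewrite (norm_homog hN) mulrC ler_wpM2l ?is_norm_ge0.
have K0 : 0 <= K by apply: sumr_ge0 => i _; exact: is_norm_ge0.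
have cphi : continuous (N \o phi).
  move=> u; apply/(cvgrPdist_le (FF := nbhs_filter u)) => e e0; near=> v => /=.
  apply: le_trans (is_norm_distl hN _ _) _; rewrite -phiB.
  apply: le_trans (phi_le _) _.
  (* K vanishes when n = 0, so K + 1 is used as the Lipschitz constant. *)
  apply: (@le_trans _ _ ((K + 1) * `|u - v|)).
    by rewrite ler_wpM2r// lerDl.
  rewrite -ler_pdivlMl ?ltr_wpDl//.
  near: v; apply: cvgr_dist_le => //.
  by rewrite mulr_gt0 ?invr_gt0 ?ltr_wpDl.
pose S := [set u : 'rV[R]_n | `|u| = 1].
have scal (u : 'rV[R]_n) : u != 0 -> S (`|u|^-1 *: u).
  move=> u0; rewrite /S /= normrZ normfV normr_id mulVf //.
  by rewrite normr_eq0.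
have phiZ a u : phi (a *: u) = a *: phi u.
  by rewrite /phi scaler_sumr; apply: eq_bigr => i _; rewrite mxE scalerA.
pose crd x : 'rV[R]_n := \row_i coord b i x.
have phiK x : phi (crd x) = x.
  rewrite [RHS](coord_basis hb (memvf x)); apply: eq_bigr => i _.
  by rewrite mxE.
suff [C C0 hC] : exists2 C, 0 <= C & forall u, `|u| <= C * N (phi u).
  exists C => // x i; apply: le_trans (_ : `|crd x| <= _); last first.
    by rewrite -{2}(phiK x).
  by have := entry_le (crd x) i; rewrite mxE.
have [[s Ss]|noS] := pselect (S !=set0); last first.
  exists 0 => // u; rewrite mul0r; have [->|u0] := eqVneq u 0.
    by rewrite normr0.
  by case: noS; exists (`|u|^-1 *: u); exact: scal.
have cS : compact S.
  apply: bounded_closed_compact.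
    by exists 1; split=> // t t1 u; rewrite /S /= => ->; exact: ltW.
  rewrite (_ : S = (fun u : 'rV[R]_n => `|u|) @^-1` [set 1])//.
  apply: closed_comp => [u _|]; last exact: closed_eq.
  exact: norm_continuous.
have [c cS' cmin] := EVT_min_rV (ex_intro _ s Ss) cS
  (continuous_subspaceT cphi).
move: cS'; rewrite inE => c1.
have Nc : 0 < N (phi c).
  rewrite lt_neqAle is_norm_ge0 // andbT eq_sym; apply/eqP.
  move=> /(norm_definite hN) phic0.
  have c0 : c = 0.
    apply/rowP => i; rewrite mxE -(coord_sum_free (fun i => c 0 i) i fb).
    by rewrite -/(phi c) phic0 linear0.
  by move: c1; rewrite /S /= c0 normr0 => /esym/eqP; rewrite oner_eq0.
exists (N (phi c))^-1 => [|u]; first by rewrite invr_ge0 ltW.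
have [->|u0] := eqVneq u 0; first by rewrite normr0 mulr_ge0 ?invr_ge0 ?is_norm_ge0.
have /= := cmin _ (mem_set (scal u u0)); rewrite phiZ (norm_homog hN).
by rewrite normfV normr_id ler_pdivlMl ?normr_gt0// ler_pdivlMl // mulrC.
Unshelve. all: by end_near.
Qed.

(** Expanding x in a basis reduces this to the bound on coordinates. With A the
    identity it is the equivalence of norms. *)
Lemma norm_hom_le (R : realType) (U V : vectType R) (NU : U -> R) (NV : V -> R)
    (A : 'Hom(U, V)) :
  is_norm NU -> is_norm NV ->
  exists2 C, 0 <= C & forall x, NV (A x) <= C * NU x.
Proof.
move=> hU hV; have hb := vbasisP {:U}.
have [C C0 hC] := coord_le_norm hU hb.
exists (C * \sum_(i < \dim {:U}) NV (A (vbasis {:U})`_i)) => [|x].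
  by rewrite mulr_ge0 // sumr_ge0 // => i _; exact: is_norm_ge0.
rewrite {1}(coord_basis hb (memvf x)) linear_sum.
apply: le_trans (is_norm_sum hV _) _.
rewrite mulrAC mulr_sumr; apply: ler_sum => i _.
by rewrite linearZ (norm_homog hV) ler_wpM2r ?is_norm_ge0.
Qed.

Lemma uniform_bound (R : realType) (I : finType) (X : I -> Type)
    (f g : forall i, X i -> R) :
  (forall i x, 0 <= g i x) ->
  (forall i, exists2 C, 0 <= C & forall x, f i x <= C * g i x) ->
  exists2 C, 0 <= C & forall i x, f i x <= C * g i x.
Proof.
move=> g0 h.
have {}h i : {C | 0 <= C & forall x, f i x <= C * g i x}.
  by apply/cid2; case: (h i) => C ? ?; exists C.
pose c i := s2val (h i); have c0 i : 0 <= c i := s2valP (h i).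
exists (\sum_i c i) => [|i x]; first exact: sumr_ge0.
apply: le_trans (s2valP' (h i) x) _.
by rewrite ler_wpM2r// (bigD1 i)//= lerDl sumr_ge0.
Qed.

Section OperatorNorm.
Variables (R : realType) (U V : vectType R) (NU : U -> R) (NV : V -> R).
Hypotheses (hU : is_norm NU) (hV : is_norm NV).
Implicit Types A : 'Hom(U, V).

Lemma opnorm_le A c :
  0 <= c -> (forall x, NV (A x) <= c * NU x) -> opnorm NU NV A <= c.
Proof.
move=> c0 hc; rewrite /opnorm; set E := [set _ | _ in _].
have [->|/set0P E0] := eqVneq E set0; first by rewrite sup0.
by apply: ge_sup => // _ [x /= x1 <-]; apply: le_trans (hc x) _; rewrite x1 mulr1.
Qed.

(** The supremum is over a bounded set, by norm_hom_le; rescaling x to the unit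
    sphere then gives the bound. *)
Lemma le_opnorm A x : NV (A x) <= opnorm NU NV A * NU x.
Proof.
have [C C0 hC] := norm_hom_le A hU hV.
have [->|x0] := eqVneq x 0; first by rewrite linear0 (is_norm0 hU) (is_norm0 hV) mulr0.
have Nx : 0 < NU x.
  rewrite lt_neqAle is_norm_ge0 // andbT eq_sym; apply: contra_neq x0.
  exact: norm_definite.
rewrite mulrC -ler_pdivrMl//; apply: ub_le_sup.
  by exists C => _ [y /= y1 <-]; apply: le_trans (hC y) _; rewrite y1 mulr1.
exists ((NU x)^-1 *: x) => /=.
  by rewrite (norm_homog hU) ger0_norm ?invr_ge0 ?ltW// mulVf// gt_eqF.
by rewrite linearZ (norm_homog hV) ger0_norm ?invr_ge0 ?ltW.
Qed.

Lemma opnorm_ge0 A : 0 <= opnorm NU NV A.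
Proof.
rewrite /opnorm; set E := [set _ | _ in _].
have [->|/set0P[_ [x /= x1 _]]] := eqVneq E set0; first by rewrite sup0.
apply: le_trans (is_norm_ge0 hV (A x)) _.
by have := le_opnorm A x; rewrite x1 mulr1.
Qed.

End OperatorNorm.

(** * Exponential growth rates of submultiplicative sequences *)

Section GrowthRate.
Variable R : realType.
Implicit Types (u : nat -> R) (r s : R).

Lemma bernoulli_le (x : R) n : 0 <= x -> 1 + n%:R * x <= (1 + x) ^+ n.
Proof.
move=> x0; elim: n => [|n IH]; first by rewrite mul0r addr0 expr0.
rewrite exprS; apply: le_trans (ler_wpM2l _ IH); last by rewrite addr_ge0.
rewrite -subr_ge0 (_ : _ - _ = n%:R * x ^+ 2) ?mulr_ge0 ?sqr_ge0 //.
by rewrite -natr1; ring.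
Qed.

(** Bernoulli's inequality for (s / r) ^+ k = (1 + d) ^+ k, which grows at least
    like 1 + k d. *)
Lemma linear_expr_le r s : 0 < r -> r < s ->
  exists2 C, 0 <= C & forall k, k.+1%:R * r ^+ k <= C * s ^+ k.
Proof.
move=> r0 rs; pose d := s / r - 1.
have d0 : 0 < d by rewrite subr_gt0 ltr_pdivlMr// mul1r.
exists (1 + d^-1) => [|k]; first by rewrite addr_ge0 // invr_ge0 ltW.
rewrite -ler_pdivlMr ?exprn_gt0// -mulrA -expr_div_n.
have -> : s / r = 1 + d by rewrite /d addrC subrK.
apply: le_trans (ler_wpM2l _ (bernoulli_le k (ltW d0))); last first.
  by rewrite addr_ge0 // invr_ge0 ltW.
rewrite -subr_ge0 (_ : _ - _ = d^-1 + k%:R * d).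
  by rewrite addr_ge0 ?mulr_ge0 ?invr_ge0 // ltW.
by rewrite -natr1; field; rewrite gt_eqF.
Qed.

(** The constant disappears on taking k-th roots: C is at most (s / r) ^+ k for
    large k. *)
Lemma near_le_rate u C r s : (forall k, 0 <= u k) -> 0 < r -> r < s ->
  (forall k, u k ^+ k <= C * r ^+ k) -> \forall k \near \oo, u k <= s.
Proof.
move=> u0 r0 rs hC; pose d := s / r - 1.
have d0 : 0 < d by rewrite subr_gt0 ltr_pdivlMr// mul1r.
have s0 : 0 < s by exact: lt_trans rs.
near=> k.
have k0 : (0 < k)%N by near: k; exists 1%N.
rewrite -(ler_pXn2r k0) ?nnegrE ?u0 ?(ltW s0)//; apply: le_trans (hC k) _.
rewrite -ler_pdivlMr ?exprn_gt0// -expr_div_n.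
have -> : s / r = 1 + d by rewrite /d addrC subrK.
apply: le_trans (bernoulli_le k (ltW d0)).
rewrite -lerBlDl -ler_pdivrMr//.
near: k; exact: nbhs_infty_ger.
Unshelve. all: by end_near.
Qed.

(** The hypotheses are on the k-th roots u k of a submultiplicative sequence, so
    that integer powers suffice. *)
Section Submultiplicative.
Variable u : nat -> R.
Hypothesis u0 : forall k, 0 <= u k.
Hypothesis uM : forall m n, u (m + n) ^+ (m + n) <= u m ^+ m * u n ^+ n.

(** Division with remainder by m: the blocks of length m contribute a factor
    r ^+ m each, the remainder takes finitely many values. *)
Lemma submult_rate r m : 0 < r -> (0 < m)%N -> u m <= r ->
  exists2 C, 0 <= C & forall k, u k ^+ k <= C * r ^+ k.
Proof.
move=> r0 m0 umr; pose F j := u j ^+ j / r ^+ j.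
have F0 j : 0 <= F j by rewrite divr_ge0 ?exprn_ge0 // ltW.
exists (\sum_(j < m) F j) => [|k]; first exact: sumr_ge0.
have block q j : u (q * m + j) ^+ (q * m + j) <= r ^+ (q * m) * u j ^+ j.
  elim: q => [|q IH]; first by rewrite mul0n add0n expr0 mul1r.
  rewrite mulSn -addnA (exprD r); apply: le_trans (uM _ _) _.
  by rewrite -mulrA ler_pM ?exprn_ge0 ?lerXn2r ?nnegrE ?(ltW r0).
have := block (k %/ m)%N (k %% m)%N; rewrite -divn_eq => /le_trans; apply.
rewrite [X in _ <= _ * _ ^+ X](divn_eq k m) exprD mulrCA ler_wpM2l ?exprn_ge0 ?(ltW r0)//.
rewrite -ler_pdivrMr ?exprn_gt0//.
rewrite (bigD1 (Ordinal (ltn_pmod k m0))) //= lerDl.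
exact: sumr_ge0.
Qed.

(** Fekete's lemma; the limit is the infimum of the u k with k positive. *)
Lemma submult_root_cvg : cvgn u.
Proof.
pose E := [set u k | k in [set k | (0 < k)%N]].
have E0 : E !=set0 by exists (u 1%N); exists 1%N.
have Elb : has_lbound E by exists 0 => _ [k _ <-].
apply/cvg_ex; exists (inf E); apply/cvgrPdist_le => e e0.
have [_ [m m0 <-] um] : exists2 y, E y & y < inf E + e / 2.
  by apply: inf_lt => //; rewrite ltrDl divr_gt0.
have r0 : 0 < inf E + e / 2 by apply: le_lt_trans um.
have [C _ hC] := submult_rate r0 m0 (ltW um).
have rs : inf E + e / 2 < inf E + e.
  by rewrite ltrD2l ltr_pdivrMr// ltr_pMr// ltr1n.
near=> k.
have k0 : (0 < k)%N by near: k; exists 1%N.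
rewrite distrC ger0_norm ?subr_ge0; last by apply: ge_inf => //; exists k.
by rewrite lerBlDl; near: k; exact: near_le_rate hC.
Unshelve. all: by end_near.
Qed.

End Submultiplicative.
End GrowthRate.

(** * Paths and the joint spectral radius *)

Section PathSplit.
Variables (R : realType) (G : multigraph) (xi : triplet R G).

Lemma path_prodS k i j (e : edge i j) (a : gpath k j) x :
  path_prod xi (Tagged (fun j => (edge i j * gpath k j)%type) (e, a)
                  : gpath k.+1 i) x = path_prod xi a (oper xi e x).
Proof. by rewrite /= comp_lfunE. Qed.

(** The two products live in different types, since the endpoints of a and c are
    not convertible; hence the comparison through an arbitrary family f. *)
Lemma path_split m n i (a : gpath (m + n) i) :
  exists (b : gpath m i) (c : gpath n (endpoint b)),
    forall (f : forall v, vtx_space xi v -> R) x,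
      f _ (path_prod xi a x) = f _ (path_prod xi c (path_prod xi b x)).
Proof.
elim: m i a => [|m IH] i a.
  by exists tt, a => f x; rewrite /= id_lfunE.
case: a => j [e a]; have [b [c hbc]] := IH j a.
exists (Tagged (fun j => (edge i j * gpath m j)%type) (e, b)), c => f x.
by rewrite (path_prodS e a) hbc (path_prodS e b).
Qed.

End PathSplit.

Section SpectralRadius.
Variables (R : realType) (G : multigraph) (xi : triplet R G) (N : multinorm xi).

Let hN i : is_norm (mnorm N (i := i)) := mnormP N i.

Lemma mnorm_ge0 i (x : vtx_space xi i) : 0 <= N i x.
Proof. exact: is_norm_ge0. Qed.

Lemma max_path_norm_ge0 k : 0 <= max_path_norm N k.
Proof. exact: bigmax_ge_id. Qed.

Lemma root_expr (x : R) k : (0 < k)%N -> 0 <= x -> (x `^ k%:R^-1) ^+ k = x.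
Proof.
move=> k0 x0; rewrite -powR_mulrn ?powR_ge0// -powRrM mulVf ?powRr1//.
by rewrite pnatr_eq0 -lt0n.
Qed.

Lemma path_norm_le k i (a : gpath k i) x :
  N _ (path_prod xi a x) <= max_path_norm N k ^+ k * N _ x.
Proof.
case: k a => [|k] a; first by rewrite expr0 mul1r /= id_lfunE.
apply: le_trans (le_opnorm (hN _) (hN _) _ x) _.
rewrite ler_wpM2r ?mnorm_ge0//.
rewrite -(@root_expr (opnorm _ _ _) k.+1)//; last exact: opnorm_ge0.
rewrite lerXn2r ?nnegrE ?powR_ge0 ?max_path_norm_ge0//.
exact: (@le_bigmax _ _ _ 0 (fun a : {i : 'I_(nvert G) & gpath k.+1 i} =>
  opnorm (N (tag a)) (N (endpoint (tagged a))) (path_prod xi (tagged a))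
       `^ (k.+1%:R^-1)) (Tagged (gpath k.+1) a)).
Qed.

Lemma max_path_normX_le k B : 0 <= B -> (0 < k)%N ->
  (forall i (a : gpath k i) x, N _ (path_prod xi a x) <= B * N _ x) ->
  max_path_norm N k ^+ k <= B.
Proof.
move=> B0 k0 hB.
rewrite -[leRHS](root_expr k0 B0) lerXn2r ?nnegrE ?powR_ge0 ?max_path_norm_ge0//.
apply: bigmax_le => [|[i a] _ /=]; first exact: powR_ge0.
rewrite ge0_ler_powR ?invr_ge0 ?nnegrE//; first exact: opnorm_ge0.
exact: opnorm_le.
Qed.

Lemma max_path_norm_submult m n :
  max_path_norm N (m + n) ^+ (m + n) <=
  max_path_norm N m ^+ m * max_path_norm N n ^+ n.
Proof.
have [|mn0] := posnP (m + n).
  by move/eqP; rewrite addn_eq0 => /andP[/eqP-> /eqP->]; rewrite !expr0 mulr1.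
apply: max_path_normX_le => // [|i a x].
  by rewrite mulr_ge0 ?exprn_ge0 ?max_path_norm_ge0.
have [b [c bc]] := path_split xi a; rewrite (bc (mnorm N)).
apply: le_trans (path_norm_le _ _) _; rewrite mulrAC [leRHS]mulrC.
by rewrite ler_wpM2l ?exprn_ge0 ?max_path_norm_ge0 ?path_norm_le.
Qed.

Lemma max_path_norm_cvg : cvgn (max_path_norm N).
Proof.
exact: submult_root_cvg max_path_norm_ge0 max_path_norm_submult.
Qed.

(** Growth bounds replace limits of roots: by jsr_lt_growth and jsr_le the joint
    spectral radius is the infimum of the rates r > 0 for which a bound holds with
    some constant C. The constant absorbs any change of norms. *)
Definition growth_bound (C r : R) : Prop :=
  forall k i (a : gpath k i) x, N _ (path_prod xi a x) <= C * r ^+ k * N i x.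

Lemma jsr_ge0 : 0 <= jsr N.
Proof.
by apply: limr_ge; [exact: max_path_norm_cvg|apply: nearW; exact: max_path_norm_ge0].
Qed.

Lemma jsr_lt_growth r : jsr N < r -> exists2 C, 0 <= C & growth_bound C r.
Proof.
move=> hr; have r0 : 0 < r := le_lt_trans jsr_ge0 hr.
have : \forall m \near \oo, (0 < m)%N /\ max_path_norm N m <= r.
  near=> m; split; first by near: m; exists 1%N.
  apply: ltW; near: m; apply: (cvgr_lt (jsr N)) => //.
  exact: max_path_norm_cvg.
move=> /filter_ex[m [m0 mr]].
have [C C0 hC] := submult_rate max_path_norm_ge0 max_path_norm_submult r0 m0 mr.
exists C => // k i a x; apply: le_trans (path_norm_le a x) _.
by rewrite ler_wpM2r ?mnorm_ge0.
Unshelve. all: by end_near.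
Qed.

Lemma jsr_le b : 0 <= b ->
  (forall r, b < r -> exists2 C, 0 <= C & growth_bound C r) -> jsr N <= b.
Proof.
move=> b0 hb; apply/ler_addgt0Pr => e e0.
have r0 : 0 < b + e / 2 by rewrite ltr_wpDl// divr_gt0.
have [|C C0 hC] := hb (b + e / 2); first by rewrite ltrDl divr_gt0.
apply: limr_le; first exact: max_path_norm_cvg.
(* The constant C + 1 covers k = 0, where the power of the path maximum is 1. *)
apply: (@near_le_rate _ _ (C + 1) _ _ max_path_norm_ge0 r0).
  by rewrite ltrD2l ltr_pdivrMr// ltr_pMr// ltr1n.
case=> [|k]; first by rewrite !expr0 mulr1 lerDr.
apply: (@le_trans _ _ (C * (b + e / 2) ^+ k.+1)).
  by apply: max_path_normX_le => //; rewrite mulr_ge0 ?exprn_ge0 ?(ltW r0).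
by rewrite ler_wpM2r ?exprn_ge0 ?lerDl ?(ltW r0).
Qed.

End SpectralRadius.

(** Constant factors do not affect r, so only boundedness of f and g matters; with
    f and g the identity this is independence of the multinorm. *)
Lemma growth_bound_compress (R : realType) (G : multigraph) (xi xi' : triplet R G)
    (N : multinorm xi) (N' : multinorm xi')
    (f : forall i, 'Hom(vtx_space xi' i, vtx_space xi i))
    (g : forall i, 'Hom(vtx_space xi i, vtx_space xi' i)) C r :
  (forall k i (a : gpath k i) x,
     path_prod xi' a x = g _ (path_prod xi a (f i x))) ->
  0 <= C -> 0 <= r -> growth_bound N C r ->
  exists2 C', 0 <= C' & growth_bound N' C' r.
Proof.
move=> fg C0 r0 hC.
have [c c0 hc] := uniform_bound (@mnorm_ge0 _ _ _ N)
  (fun i => norm_hom_le (g i) (mnormP N i) (mnormP N' i)).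
have [d d0 hd] := uniform_bound (@mnorm_ge0 _ _ _ N')
  (fun i => norm_hom_le (f i) (mnormP N' i) (mnormP N i)).
exists (c * C * d) => [|k i a x]; first by rewrite !mulr_ge0.
rewrite fg; apply: le_trans (hc _ _) _.
rewrite [leRHS](_ : _ = c * (C * r ^+ k * (d * N' i x))); last by ring.
rewrite ler_wpM2l//; apply: le_trans (hC _ _ _ _) _.
by rewrite ler_wpM2l ?mulr_ge0 ?exprn_ge0.
Qed.

(** * Coordinates in adapted bases *)

Section AdaptedCoordinates.
Variables (R : realType) (V : vectType R) (U W : {vspace V}) (m p : nat).
Variables (X : m.-tuple (subvs_of U)) (Y : p.-tuple (subvs_of W)).

Lemma adapted_family_lshift (c : 'I_m) :
  (adapted_family X Y)`_(lshift p c) = vsval X`_c.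
Proof.
by rewrite /= nth_cat size_map size_tuple ltn_ord (nth_map 0) ?size_tuple.
Qed.

Lemma adapted_family_rshift (c : 'I_p) :
  (adapted_family X Y)`_(rshift m c) = vsval Y`_c.
Proof.
rewrite /= nth_cat size_map size_tuple ltnNge leq_addr /= addKn.
by rewrite (nth_map 0) ?size_tuple.
Qed.

Hypotheses (UW : (U + W)%VS = fullv) (dUW : directv (U + W)).
Hypotheses (hX : basis_of fullv X) (hY : basis_of fullv Y).

Lemma coord_adapted (x : subvs_of U) (y : subvs_of W) i :
  coord (adapted_family X Y) i (vsval x + vsval y) =
  match fintype.split i with inl j => coord X j x | inr j => coord Y j y end.
Proof.
have fZ := basis_free (adapted_family_basis UW dUW hX hY).
rewrite -(coord_sum_free (fun i => match fintype.split i with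
  inl j => coord X j x | inr j => coord Y j y end) i fZ).
congr (coord _ _ _); rewrite big_split_ord /=; congr (_ + _).
  rewrite {1}(coord_basis hX (memvf x)) linear_sum; apply: eq_bigr => j _.
  by rewrite (unsplitK (inl j)) adapted_family_lshift linearZ.
rewrite {1}(coord_basis hY (memvf y)) linear_sum; apply: eq_bigr => j _.
by rewrite (unsplitK (inr j)) adapted_family_rshift linearZ.
Qed.

Lemma coord_adapted_lshift (x : subvs_of U) (y : subvs_of W) (j : 'I_m) :
  coord (adapted_family X Y) (lshift p j) (vsval x + vsval y) = coord X j x.
Proof. by rewrite coord_adapted (unsplitK (inl j)). Qed.

Lemma coord_adapted_rshift (x : subvs_of U) (y : subvs_of W) (j : 'I_p) :
  coord (adapted_family X Y) (rshift m j) (vsval x + vsval y) = coord Y j y.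
Proof. by rewrite coord_adapted (unsplitK (inr j)). Qed.

End AdaptedCoordinates.

Lemma total_dim_gt0 (R : realType) (G : multigraph) (xi : triplet R G) :
  (0 < total_dim xi)%N.
Proof.
by case: xi => V A [i hi]; rewrite /total_dim (bigD1 i) //= ltn_addr.
Qed.

(** * The block decomposition *)

Lemma proj_alongE (R : realType) (V : vectType R) (U W : {vspace V}) x :
  vsval (proj_along U W x) = daddv_pi U W x.
Proof. by rewrite lfunE /= vsprojK // memv_pi. Qed.

Section Projections.
Variables (R : realType) (V : vectType R) (U W : {vspace V}).
Hypotheses (UW : (U + W)%VS = fullv) (dUW : directv (U + W)).

Let capUW : (U :&: W)%VS = 0%VS. Proof. exact/directv_addP. Qed.

Lemma proj_along_id (y : subvs_of U) : proj_along U W (vsval y) = y.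
Proof. by apply: val_inj; rewrite /= proj_alongE daddv_pi_id // subvsP. Qed.

Lemma proj_along_add x :
  x = vsval (proj_along U W x) + vsval (proj_along W U x).
Proof. by rewrite !proj_alongE daddv_pi_add // UW memvf. Qed.

Lemma proj_along_ker (y : subvs_of U) : proj_along W U (vsval y) = 0.
Proof.
apply: subvs_inj; have := proj_along_add (vsval y).
by rewrite proj_along_id -{1}[vsval y]addr0 => /addrI/esym ->; rewrite linear0.
Qed.

End Projections.

Section Blocks.
Variables (R : realType) (G : multigraph) (xi : triplet R G).
Variables (emb : embedded xi) (st : strict emb).
Variables (L2 : forall i, {vspace vtx_space xi i}) (hL2 : complementary emb L2).
Let xi1 := embedded_triplet emb.
Let xi2 := complement_triplet st hL2.
Let P1 i : 'Hom(vtx_space xi i, vtx_space xi1 i) :=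
  proj_along (sub_space emb i) (L2 i).
Let P2 i : 'Hom(vtx_space xi i, vtx_space xi2 i) :=
  proj_along (L2 i) (sub_space emb i).
Let v1 i : 'Hom(vtx_space xi1 i, vtx_space xi i) := linfun vsval.
Let v2 i : 'Hom(vtx_space xi2 i, vtx_space xi i) := linfun vsval.

Let full i : (sub_space emb i + L2 i)%VS = fullv. Proof. by case: (hL2 i). Qed.
Let direct i : directv (sub_space emb i + L2 i). Proof. by case: (hL2 i). Qed.
Let full' i : (L2 i + sub_space emb i)%VS = fullv.
Proof. by rewrite addvC. Qed.
Let direct' i : directv (L2 i + sub_space emb i).
Proof. by apply/directv_addP; rewrite capvC; exact/directv_addP. Qed.

Let v1E i x : v1 i x = vsval x. Proof. exact: (lfunE vsval). Qed.
Let v2E i x : v2 i x = vsval x. Proof. exact: (lfunE vsval). Qed.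
Let decomp i (x : vtx_space xi i) : x = v1 i (P1 i x) + v2 i (P2 i x).
Proof. by rewrite v1E v2E; exact: proj_along_add. Qed.
Let P1v1 i x : P1 i (v1 i x) = x. Proof. by rewrite v1E; exact: proj_along_id. Qed.
Let P2v2 i x : P2 i (v2 i x) = x. Proof. by rewrite v2E; exact: proj_along_id. Qed.
Let P2v1 i x : P2 i (v1 i x) = 0. Proof. by rewrite v1E; exact: proj_along_ker. Qed.
Let P1v2 i x : P1 i (v2 i x) = 0. Proof. by rewrite v2E; exact: proj_along_ker. Qed.

Lemma oper_sub i j (e : edge i j) x : oper xi e (v1 i x) = v1 j (oper xi1 e x).
Proof. by rewrite !v1E /= sub_operE. Qed.

Lemma oper_compl i j (e : edge i j) x :
  oper xi2 e x = P2 j (oper xi e (v2 i x)).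
Proof. by rewrite /= !comp_lfunE. Qed.

Lemma proj_oper i j (e : edge i j) x :
  P2 j (oper xi e x) = oper xi2 e (P2 i x).
Proof.
rewrite {1}(decomp x) !linearD /= -/(oper xi e) oper_sub P2v1 add0r.
by rewrite oper_compl.
Qed.

Lemma path_prod_sub k i (a : gpath k i) x :
  path_prod xi a (v1 i x) = v1 _ (path_prod xi1 a x).
Proof.
elim: k i a x => [|k IH] i; first by move=> a x; rewrite /= !id_lfunE.
by case=> j [e a] x; rewrite !path_prodS oper_sub IH.
Qed.

Lemma proj_path_prod k i (a : gpath k i) x :
  P2 _ (path_prod xi a x) = path_prod xi2 a (P2 _ x).
Proof.
elim: k i a x => [|k IH] i; first by move=> a x; rewrite /= !id_lfunE.
by case=> j [e a] x; rewrite !path_prodS IH proj_oper.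
Qed.

Lemma mx_in_adapted_bases
    (b1 : forall i, (\dim {: vtx_space xi1 i}).-tuple (vtx_space xi1 i))
    (b2 : forall i, (\dim {: vtx_space xi2 i}).-tuple (vtx_space xi2 i)) :
  (forall i, basis_of fullv (b1 i)) -> (forall i, basis_of fullv (b2 i)) ->
  forall i j (e : edge i j), exists D,
    mx_in_bases (adapted_family (b1 i) (b2 i)) (adapted_family (b1 j) (b2 j))
                (oper xi e)
    = block_mx (mx_in_bases (b1 i) (b1 j) (oper xi1 e)) D
               0 (mx_in_bases (b2 i) (b2 j) (oper xi2 e)).
Proof.
move=> hb1 hb2 i j e; set M := mx_in_bases _ _ _.
have coordl := coord_adapted_lshift (full j) (direct j) (hb1 j) (hb2 j).
have coordr := coord_adapted_rshift (full j) (direct j) (hb1 j) (hb2 j).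
have h1 (x : vtx_space xi1 i) :
    oper xi e (vsval x) = vsval (oper xi1 e x) + vsval (0 : subvs_of (L2 j)).
  by rewrite linear0 addr0 -!v1E oper_sub.
have h2 (y : vtx_space xi2 i) : oper xi e (vsval y) =
    vsval (P1 j (oper xi e (vsval y))) + vsval (oper xi2 e y).
  by rewrite oper_compl -(v2E y) {1}(decomp (oper xi e (v2 i y))) v1E (v2E (P2 j _)).
exists (ursubmx M); rewrite -[LHS]submxK; congr block_mx; apply/matrixP => r c;
  rewrite !mxE ?adapted_family_lshift ?adapted_family_rshift.
- by rewrite h1 coordl.
- by rewrite h1 coordr linear0.
- by rewrite h2 coordr.
Qed.

Lemma total_dim_blocks : total_dim xi = (total_dim xi1 + total_dim xi2)%N.
Proof.
rewrite /total_dim -big_split; apply: eq_bigr => i _ /=.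
rewrite -(full i) dimv_disjoint_sum; last exact/directv_addP.
by congr (_ + _)%N; rewrite dimvf.
Qed.

Variables (N : multinorm xi) (N1 : multinorm xi1) (N2 : multinorm xi2).

(** The off-diagonal block of a path of length k is a sum of k products: a part of
    the path in the complement, one off-diagonal edge, the rest of the path in the
    subsystem. The least s allowed for y is its value in a norm for which every
    edge of the complement has norm at most r, so stripping the first edge turns
    s into r * s. Using the norm of the edge in N2 instead would lose a constant
    factor at every step. *)
Lemma offdiag_le C1 d r s k i (a : gpath k i) y :
  0 < r -> 0 <= C1 -> 0 <= d ->
  growth_bound N1 C1 r ->
  (forall i j (e : edge i j) y,
     N1 _ (P1 _ (oper xi e (v2 _ y))) <= d * N2 i y) ->
  (forall l (b : gpath l i), N2 _ (path_prod xi2 b y) <= r ^+ l * s) ->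
  N1 _ (P1 _ (path_prod xi a (v2 _ y))) <= k%:R * (C1 * d / r * s) * r ^+ k.
Proof.
move=> r0 C10 d0 hC1 hd; elim: k i a y s => [|k IH] i.
  by move=> a y s _; rewrite /= id_lfunE P1v2 !mul0r (is_norm0 (mnormP N1 _)).
case=> j [e a] y s hs; rewrite path_prodS (decomp (oper xi e (v2 _ y))).
rewrite -oper_compl linearD linearD /= path_prod_sub P1v1.
apply: le_trans (norm_triangle (mnormP N1 _) _ _) _.
have ys : N2 i y <= s.
  by have := hs 0%N tt; rewrite /= id_lfunE expr0 mul1r.
have h2 : N1 _ (P1 _ (path_prod xi a (v2 _ (oper xi2 e y)))) <=
    k%:R * (C1 * d / r * (r * s)) * r ^+ k.
  apply: IH => l b; rewrite mulrA -exprSr.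
  have := hs l.+1 (Tagged (fun j => (edge i j * gpath l j)%type) (e, b)).
  by rewrite path_prodS.
have h1 : N1 _ (path_prod xi1 a (P1 j (oper xi e (v2 _ y)))) <=
    C1 * r ^+ k * (d * s).
  apply: le_trans (hC1 _ _ _ _) _; rewrite ler_wpM2l//.
    by rewrite mulr_ge0 // exprn_ge0 // ltW.
  by apply: le_trans (hd _ _ _ _) _; rewrite ler_wpM2l.
apply: le_trans (lerD h1 h2) _; rewrite le_eqVlt; apply/orP; left; apply/eqP.
by rewrite exprS -natr1; field; rewrite gt_eqF.
Qed.

Lemma growth_bound_blocks C1 C2 r s : 0 < r -> r < s -> 0 <= C1 -> 0 <= C2 ->
  growth_bound N1 C1 r -> growth_bound N2 C2 r ->
  exists2 C, 0 <= C & growth_bound N C s.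
Proof.
move=> r0 rs C10 C20 hC1 hC2.
have [c1 c10 hc1] := uniform_bound (@mnorm_ge0 _ _ _ N)
  (fun i => norm_hom_le (P1 i) (mnormP N i) (mnormP N1 i)).
have [c2 c20 hc2] := uniform_bound (@mnorm_ge0 _ _ _ N)
  (fun i => norm_hom_le (P2 i) (mnormP N i) (mnormP N2 i)).
have [b1 b10 hb1] := uniform_bound (@mnorm_ge0 _ _ _ N1)
  (fun i => norm_hom_le (v1 i) (mnormP N1 i) (mnormP N i)).
have [b2 b20 hb2] := uniform_bound (@mnorm_ge0 _ _ _ N2)
  (fun i => norm_hom_le (v2 i) (mnormP N2 i) (mnormP N i)).
have [d d0 hd] : exists2 d, 0 <= d & forall i j (e : edge i j) y,
    N1 _ (P1 _ (oper xi e (v2 _ y))) <= d * N2 i y.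
  have [|d d0 hd] := @uniform_bound R
    {i : 'I_(nvert G) & {j : 'I_(nvert G) & edge i j}}
    (fun t => vtx_space xi2 (tag t))
    (fun t y => N1 _ (P1 _ (oper xi (tagged (tagged t)) (v2 _ y))))
    (fun t y => N2 _ y) (fun t y => mnorm_ge0 N2 y).
    case=> i [j e] /=; have [c ? h] := norm_hom_le
      (P1 j \o oper xi e \o v2 i)%VF
      (mnormP N2 i) (mnormP N1 j).
    by exists c => // y; have := h y; rewrite !comp_lfunE.
  by exists d => // i j e y; exact: (hd (Tagged _ (Tagged (edge i) e)) y).
have [K K0 hK] := linear_expr_le r0 rs.
pose M := b1 * (C1 * c1 + C1 * d / r * (C2 * c2)) + b2 * (C2 * c2).
have r'0 : 0 <= r^-1 by rewrite invr_ge0 ltW.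
have M0 : 0 <= M by rewrite /M !(addr_ge0, mulr_ge0).
exists (M * K) => [|k i a x]; first exact: mulr_ge0.
apply: (@le_trans _ _ (M * (k.+1%:R * r ^+ k) * N i x)); last first.
  by rewrite -(mulrA M K) ler_wpM2r ?mnorm_ge0 // ler_wpM2l.
rewrite (decomp (path_prod xi a x)) proj_path_prod.
apply: le_trans (norm_triangle (mnormP N _) _ _) _.
have h1 : N1 _ (P1 _ (path_prod xi a x)) <=
    C1 * r ^+ k * (c1 * N i x) + k%:R * (C1 * d / r * (C2 * (c2 * N i x))) * r ^+ k.
  rewrite {1}(decomp x) !linearD /= path_prod_sub P1v1.
  apply: le_trans (norm_triangle (mnormP N1 _) _ _) _.
  apply: lerD.
    apply: le_trans (hC1 _ _ _ _) _.
    by rewrite ler_wpM2l ?mulr_ge0 ?exprn_ge0 // ltW.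
  apply: offdiag_le => // l b; apply: le_trans (hC2 _ _ _ _) _.
  by rewrite [leRHS]mulrCA mulrA ler_wpM2l ?mulr_ge0 ?exprn_ge0 ?(ltW r0).
have h2 : N2 _ (path_prod xi2 a (P2 i x)) <= C2 * r ^+ k * (c2 * N i x).
  apply: le_trans (hC2 _ _ _ _) _.
  by rewrite ler_wpM2l ?mulr_ge0 ?exprn_ge0 // ltW.
apply: le_trans (lerD (hb1 _ _) (hb2 _ _)) _.
apply: le_trans (lerD (ler_wpM2l b10 h1) (ler_wpM2l b20 h2)) _.
pose X := r ^+ k * N i x.
have X0 : 0 <= X by rewrite mulr_ge0 ?mnorm_ge0 ?exprn_ge0 ?(ltW r0).
rewrite -subr_ge0 (_ : _ - _ = (b1 * (k%:R * (C1 * c1) + C1 * d / r * (C2 * c2))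
    + b2 * (C2 * c2) * k%:R) * X).
  by apply: mulr_ge0; rewrite // !(addr_ge0, mulr_ge0).
by rewrite /M /X -natr1; ring.
Qed.

Lemma jsr_blocks : jsr N = Num.max (jsr N1) (jsr N2).
Proof.
apply/eqP; rewrite eq_le; apply/andP; split.
  apply: jsr_le => [|s]; first by rewrite le_max jsr_ge0.
  set m := Num.max _ _ => ms.
  (* The gap between r and s absorbs the factor k + 1 of the off-diagonal block. *)
  pose r := (m + s) / 2.
  have mr : m < r by rewrite /r midf_lt.
  have rs : r < s by rewrite /r midf_lt.
  have /andP[r1 r2] : (jsr N1 < r) && (jsr N2 < r) by rewrite -gt_max.
  have [C1 C10 h1] := jsr_lt_growth r1.
  have [C2 C20 h2] := jsr_lt_growth r2.
  apply: growth_bound_blocks rs C10 C20 h1 h2.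
  exact: le_lt_trans (jsr_ge0 _) r1.
rewrite ge_max; apply/andP; split; apply: jsr_le (jsr_ge0 N) _ => r hr;
  have [C C0 hC] := jsr_lt_growth hr; have r0 := le_trans (jsr_ge0 N) (ltW hr).
- apply: (@growth_bound_compress _ _ _ _ _ _ v1 P1 _ _ _ C0 r0 hC) => k i a x.
  by rewrite path_prod_sub P1v1.
- apply: (@growth_bound_compress _ _ _ _ _ _ v2 P2 _ _ _ C0 r0 hC) => k i a x.
  by rewrite proj_path_prod P2v2.
Qed.

End Blocks.

Theorem theorem2 (R : realType) (G : multigraph) (xi : triplet R G)
    (xi_red : reducible xi)
    (emb1 : embedded xi) (st1 : strict emb1)
    (L2 : forall i, {vspace vtx_space xi i}) (hL2 : complementary emb1 L2) :
  let xi1 := embedded_triplet emb1 in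
  let xi2 := complement_triplet st1 hL2 in
  [/\ (total_dim xi1 < total_dim xi)%N,
      (total_dim xi2 < total_dim xi)%N,
      (forall (b1 : forall i, (\dim {: vtx_space xi1 i}).-tuple (vtx_space xi1 i))
              (b2 : forall i, (\dim {: vtx_space xi2 i}).-tuple (vtx_space xi2 i)),
         (forall i, basis_of fullv (b1 i)) ->
         (forall i, basis_of fullv (b2 i)) ->
         forall i j (e : edge i j),
         exists D,
           mx_in_bases (adapted_family (b1 i) (b2 i))
                       (adapted_family (b1 j) (b2 j)) (oper xi e)
           = block_mx (mx_in_bases (b1 i) (b1 j) (oper xi1 e)) D
                      0 (mx_in_bases (b2 i) (b2 j) (oper xi2 e)))
    & forall (N : multinorm xi) (N1 : multinorm xi1) (N2 : multinorm xi2),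
        jsr N = Num.max (jsr N1) (jsr N2)].
Proof.
move=> xi1 xi2; split.
- by rewrite (total_dim_blocks st1 hL2) -addn1 leq_add2l total_dim_gt0.
- by rewrite (total_dim_blocks st1 hL2) -add1n leq_add2r total_dim_gt0.
- exact: mx_in_adapted_bases.
- exact: jsr_blocks.
Qed.
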